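(* Let $\mathcal{C}$ be a category with covers and with a (fixed) weak initial object $I$. Let $\mathcal{R}$ be an equivalence relation on $\mathrm{Mor}_{\mathcal{C}}(c,c')$ for each $c,c'\in\mathcal{C}$ which preserves composition. Let $f:X\to Y$ be any morphism in $\mathcal{C}$. If $Y$ is $\mathcal{R}$-connected, then $$\mathcal{R}\text{-}\mathrm{sec}(f)\leq\mathrm{cat}_{\mathcal{R}}(Y).$$
   Context: Sieves and covers: for a category $\mathcal{C}$ and an object $C$, the overcategory $\mathcal{C}_{|C}$ has as objects the morphisms with codomain $C$. A sieve on $C$ is a full subcategory $S\subset\mathcal{C}_{|C}$ (i.e. a class of morphisms with codomain $C$) such that $f\in S$ implies $f\circ g\in S$ for every $g$ with $\mathrm{codom}(g)=\mathrm{dom}(f)$. The sieve generated by a family $\{f_i:C_i\to C\}_{i\in I}$ consists of all $g:D\to C$ that factor as $D\to C_i\xrightarrow{f_i}C$ for some $i$ in the index set. A topology on $\mathcal{C}$ assigns to each object $C$ a collection of sieves on $C$, called covering sieves (no axioms are required); a category equipped with a topology is a category with covers. A family of morphisms with codomain $C$ is a covering for $C$ if it generates a covering sieve on $C$. The relation $\mathcal{R}$ preserves composition if $f\,\mathcal{R}\,h$ in $\mathrm{Mor}_{\mathcal{C}}(c,c')$ and $f'\,\mathcal{R}\,h'$ in $\mathrm{Mor}_{\mathcal{C}}(c'',c)$ imply $(f\circ f')\,\mathcal{R}\,(h\circ h')$. Given $f:X\to Y$ and $g:Z\to Y$, an $\mathcal{R}$-$g$-section of $f$ is a morphism $s:Z\to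 X$ with $(f\circ s)\,\mathcal{R}\,g$. $\mathcal{R}\text{-}\mathrm{sec}(f)$ is the least integer $m\ge 1$ such that there is a covering $\{g_j:Y_j\to Y\}_{j=1}^m$ for $Y$ such that $f$ admits an $\mathcal{R}$-$g_j$-section for each $j$, and $\infty$ if no such $m$ exists. A weak initial object of $\mathcal{C}$ is an object $I$ such that for every object $X$ there is a (not necessarily unique) morphism $I\to X$. With $I$ fixed, an object $Y$ is $\mathcal{R}$-connected if $i\,\mathcal{R}\,i'$ for any morphisms $i,i':I\to Y$. The LS category of an $\mathcal{R}$-connected object $Y$ is $\mathrm{cat}_{\mathcal{R}}(Y)=\mathcal{R}\text{-}\mathrm{sec}(i)$ for some morphism $i:I\to Y$ (this does not depend on the choice of $i$ when $\mathcal{R}$ is an equivalence relation preserving composition). *)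

(* Defs.v *)
From mathcomp Require Import all_boot all_order ssralg ssrnum ssrint.
From mathcomp Require Import boolp constructive_ereal.

Set Implicit Arguments.
Unset Strict Implicit.
Unset Printing Implicit Defensive.

Record category := Category {
  obj :> Type;
  mor : obj -> obj -> Type;
  idmor : forall a, mor a a;
  mcomp : forall a b c, mor b c -> mor a b -> mor a c;
  mcomp_idl : forall a b (f : mor a b), mcomp (idmor b) f = f;
  mcomp_idr : forall a b (f : mor a b), mcomp f (idmor a) = f;
  mcompA : forall a b c d (f : mor c d) (g : mor b c) (h : mor a b),
    mcomp f (mcomp g h) = mcomp (mcomp f g) h }.

Arguments mor {C} _ _ : rename.
Arguments idmor {C} a : rename.

Declare Scope cat_scope.
Delimit Scope cat_scope with cat.
Local Open Scope cat_scope.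
Notation "g \o f" := (mcomp g f) : cat_scope.

(* A full subcategory of the overcategory is determined by its objects, so a
   sieve is a predicate on the morphisms with codomain [a]. *)
Record sieve (C : category) (a : C) := Sieve {
  in_sieve :> forall b, mor b a -> Prop;
  sieve_closed : forall b d (f : mor b a) (g : mor d b),
    in_sieve f -> in_sieve (f \o g) }.

Section GeneratedSieve.
Variables (C : category) (a : C) (J : Type) (dom : J -> C).
Variable fam : forall j, mor (dom j) a.

Definition factors_through_family (b : C) (g : mor b a) : Prop :=
  exists (j : J) (h : mor b (dom j)), g = fam j \o h.

Lemma factors_through_family_closed (b d : C) (f : mor b a) (g : mor d b) :
  factors_through_family f -> factors_through_family (f \o g).
Proof. by move=> [j [h ->]]; exists j, (h \o g); rewrite mcompA. Qed.

Definition generated_sieve : sieve a := Sieve factors_through_family_closed.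

End GeneratedSieve.

(* No axioms are imposed on the covering sieves. *)
Definition topology (C : category) := forall a : C, sieve a -> Prop.

Definition is_covering (C : category) (T : topology C) (a : C) (J : Type)
    (dom : J -> C) (fam : forall j, mor (dom j) a) : Prop :=
  T a (generated_sieve fam).

Definition mor_rel (C : category) := forall a b : C, mor a b -> mor a b -> Prop.

Definition preserves_composition (C : category) (R : mor_rel C) : Prop :=
  forall (a b d : C) (f h : mor a b) (f' h' : mor d a),
    R a b f h -> R d a f' h' -> R d b (f \o f') (h \o h').

Definition is_rel_section (C : category) (R : mor_rel C) (x y z : C)
    (f : mor x y) (g : mor z y) (s : mor z x) : Prop :=
  R z y (f \o s) g.

Definition has_sectional_cover (C : category) (T : topology C) (R : mor_rel C)
    (x y : C) (f : mor x y) (m : nat) : Prop :=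
  exists (dom : 'I_m -> C) (g : forall j, mor (dom j) y),
    is_covering T g /\ forall j, exists s, is_rel_section R f (g j) s.

(* The values lie in the positive integers extended by +oo, seen in [\bar int]
   in order to use the library's order on extended numbers. *)
Definition rsec (C : category) (T : topology C) (R : mor_rel C)
    (x y : C) (f : mor x y) : \bar int :=
  match pselect (exists m, (0 < m)%N && `[< has_sectional_cover T R f m >]) with
  | left exm => ((ex_minn exm)%:Z)%:E%E
  | right _ => +oo%E
  end.

Definition weak_initial (C : category) (I : C) : Prop :=
  forall x : C, inhabited (mor I x).

Definition rel_connected (C : category) (R : mor_rel C) (I y : C) : Prop :=
  forall i i' : mor I y, R I y i i'.

(* [inhabited_witness] chooses some morphism from [I] to [y].  The value is
   meaningful for a connected object [y], where it does not depend on this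
   choice when [R] is an equivalence relation that preserves composition. *)
Definition rcat (C : category) (T : topology C) (R : mor_rel C)
    (I : C) (hI : weak_initial I) (y : C) : \bar int :=
  rsec T R (inhabited_witness (hI y)).

(* Main.v *)
(** Let [i : I -> Y] be the morphism whose [rsec] is the category of [Y], and
    choose [k : I -> X].  Connectedness of [Y] gives [f \o k R i], so if [s] is
    a section of [i] over [g], then [k \o s] is a section of [f] over [g]: every
    cover that serves for [i] serves for [f]. *)
Require Import Defs.
From mathcomp Require Import all_boot all_order ssralg ssrnum ssrint.
From mathcomp Require Import boolp constructive_ereal.

(** A minimum over a larger set of integers is smaller, and the empty set counts as [+oo]. *)
Lemma rsec_le (C : category) (T : topology C) (R : mor_rel C)
    (x x' y : C) (f : mor x y) (f' : mor x' y) :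
  (forall m, has_sectional_cover T R f' m -> has_sectional_cover T R f m) ->
  (rsec T R f <= rsec T R f')%E.
Proof.
move=> sub; rewrite /rsec.
case: pselect => [exm'|nexm']; case: pselect => [exm|nexm]; rewrite ?leey //.
- rewrite lee_fin lez_nat.
  case: ex_minnP => n _ n_min; case: ex_minnP => m /andP[m_gt0 /asboolP covm] _.
  by apply: n_min; rewrite m_gt0; apply/asboolP/sub.
(* The value for [f] cannot be infinite when the one for [f'] is finite: a cover for [f'] is one for
   [f]. *)
- case: nexm'.
  by case: exm => m /andP[m_gt0 /asboolP/sub covm]; exists m; rewrite m_gt0; apply/asboolP.
Qed.

(** Composing [f \o k R i] with [s R s] gives [f \o k \o s R i \o s], and [i \o s R g] by the choice
    of [s]; transitivity concludes. *)
Lemma is_rel_section_comp (C : category) (R : mor_rel C)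
    (R_equiv : forall c c' : C, RelationClasses.Equivalence (R c c'))
    (R_comp : preserves_composition R)
    (w x y z : C) (f : mor x y) (i : mor w y) (k : mor w x)
    (g : mor z y) (s : mor z w) :
  is_rel_section R f i k -> is_rel_section R i g s ->
  is_rel_section R f g (k \o s)%cat.
Proof.
rewrite /is_rel_section mcompA => Rfk Ris.
have Rs : R z w s s by apply: RelationClasses.Equivalence_Reflexive.
exact: RelationClasses.Equivalence_Transitive (R_comp _ _ _ _ _ _ _ Rfk Rs) Ris.
Qed.

Theorem theorem3p30 (C : category) (T : topology C)
    (I : C) (hI : weak_initial I)
    (R : mor_rel C)
    (R_equiv : forall c c' : C, RelationClasses.Equivalence (R c c'))
    (R_comp : preserves_composition R)
    (X Y : C) (f : mor X Y) :
  rel_connected R I Y -> (rsec T R f <= rcat T R hI Y)%E.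
Proof.
move=> Yconn; have [k] := hI X.
apply: rsec_le => m [dom [g [covg secg]]].
exists dom, g; split=> // j; have [s secs] := secg j.
exists (k \o s)%cat; exact: is_rel_section_comp (Yconn _ _) secs.
Qed.
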